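(* Let $d\ge5$, and suppose that the polynomial $p_d(m,n)$ with which $E_d(m,n)$ agrees on $\{m,n\ge\max(d-1,2)\}$ has no monomial of total degree above $d-2$ and that its homogeneous part of total degree $d-2$ is $\frac{4}{(d-2)!}\,(m^{d-2}+n^{d-2})$. Then for all integers $1\le a\le b$ with $a+b=d$, the remainder $R_{(a,b)}$ has total degree at most $d-3$.
   Context: $G_{m,n}$ is the $m\times n$ grid graph with cells $(i,j)$, $1\le i\le m$, $1\le j\le n$, two cells adjacent when they differ by one in a single coordinate. A height function on $G_{m,n}$ is a map $h\colon G_{m,n}\to\mathbb{Z}$ with $|h(u)-h(v)|=1$ on every edge $uv$ and $h(1,1)=0$. A cell is a strict local minimum (maximum) if every neighbour has value larger (smaller) by one; the extrema are the strict local minima and maxima. $E_d(m,n)$ is the number of height functions on $G_{m,n}$ with exactly $d$ extrema. For each $d\ge2$, $p_d(m,n)$ denotes the (unique) bivariate polynomial that agrees with $E_d(m,n)$ for all $m,n\ge\max(d-1,2)$; such a polynomial exists. The sides of $G_{m,n}$ are the top row $i=1$, bottom row $i=m$, left column $j=1$ and right column $j=n$. For $a,b\ge1$ and $m,n\ge2$, the remainder $R_{(a,b)}(m,n)$ is the number of height functions on $G_{m,n}$ with exactly $a$ strict local minima and exactly $b$ strict local maxima whose strict local minima do not all lie on a single side. With $d=a+b\ge3$ and $a\le b$, $R_{(a,b)}$ agrees with a bivariate polynomial on $\{m,n\ge 2d-1\}$, and its total degree means the total degree of that polynomial. *)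

(* Defs.v *)
From mathcomp Require Import all_boot all_order all_algebra.
From mathcomp Require Import finmap mpoly.
From mathcomp Require Import boolp classical_sets functions cardinality.
From mathcomp Require Import zify.

Set Implicit Arguments.
Unset Strict Implicit.
Unset Printing Implicit Defensive.

Import Order.TTheory GRing.Theory Num.Theory.

Local Open Scope ring_scope.

(* Rows and columns are numbered from 0, so the corner (1,1) is (0,0) here. *)
Definition cell (m n : nat) : finType := ('I_m * 'I_n)%type.

Definition adjacent (m n : nat) (u v : cell m n) : bool :=
  ((u.1 == v.1) && ((u.2.+1 == v.2 :> nat) || (v.2.+1 == u.2 :> nat)))
  || ((u.2 == v.2) && ((u.1.+1 == v.1 :> nat) || (v.1.+1 == u.1 :> nat))).

Definition is_height (m n : nat) (h : {ffun cell m n -> int}) : bool :=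
  [forall u, forall v, adjacent u v ==> (`|h u - h v| == 1)]
  && [forall u : cell m n,
        ((u.1 == 0%N :> nat) && (u.2 == 0%N :> nat)) ==> (h u == 0)].

Definition local_minima (m n : nat) (h : {ffun cell m n -> int}) :
    {set cell m n} :=
  [set u | [forall v, adjacent u v ==> (h v == h u + 1)]].

Definition local_maxima (m n : nat) (h : {ffun cell m n -> int}) :
    {set cell m n} :=
  [set u | [forall v, adjacent u v ==> (h v == h u - 1)]].

Definition extrema (m n : nat) (h : {ffun cell m n -> int}) : {set cell m n} :=
  local_minima h :|: local_maxima h.

(* Top row, bottom row, left column, right column. *)
Definition sides (m n : nat) : seq {set cell m n} :=
  [:: [set u : cell m n | u.1 == 0%N :> nat];
      [set u : cell m n | u.1.+1 == m :> nat];
      [set u : cell m n | u.2 == 0%N :> nat];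
      [set u : cell m n | u.2.+1 == n :> nat]].

Definition on_single_side (m n : nat) (A : {set cell m n}) : bool :=
  has (fun S : {set cell m n} => A \subset S) (sides m n).

(* [fset_set] sends infinite sets to the empty one; [finite_heights] below
   shows that this never happens here. *)
Definition num_heights (m n : nat) (P : pred {ffun cell m n -> int}) : nat :=
  #|` fset_set [set h : {ffun cell m n -> int} | is_height h && P h]%classic |.

Definition E (d m n : nat) : nat :=
  num_heights (fun h : {ffun cell m n -> int} => #|extrema h| == d).

Definition remainder (a b m n : nat) : nat :=
  num_heights (fun h : {ffun cell m n -> int} =>
    [&& #|local_minima h| == a, #|local_maxima h| == b
      & ~~ on_single_side (local_minima h)]).

(* The variables 'X_0 and 'X_1 stand for m and n. *)
Definition eval2 (p : {mpoly rat[2]}) (m n : nat) : rat :=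
  p.@[fun k : 'I_2 => if k == ord0 then m%:R else n%:R].

Definition agrees_from (N : nat) (F : nat -> nat -> nat) (p : {mpoly rat[2]}) :
    Prop :=
  forall m n : nat, (N <= m)%N -> (N <= n)%N -> (F m n)%:R = eval2 p m n.

(* [msize] is one more than the total degree, and 0 for the zero polynomial. *)
Definition total_degree_le (p : {mpoly rat[2]}) (k : nat) : Prop :=
  (msize p <= k.+1)%N.

Lemma height_bound (m n : nat) (h : {ffun cell m n -> int}) :
  is_height h -> forall u : cell m n, (`|h u|%N <= m + n)%N.
Proof.
case/andP=> /forallP hadj /forallP h0 u.
have step v w : adjacent v w -> (`|h w|%N <= `|h v|%N + 1)%N.
  move=> vw; have /forallP/(_ w) := hadj v; rewrite vw /= => /eqP; lia.
suff H : forall k (v : cell m n), (v.1 + v.2)%N = k -> (`|h v|%N <= k)%N.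
  apply: (leq_trans (H _ u erefl)).
  by rewrite leq_add // ltnW // ltn_ord.
elim=> [|k IH] [[i Hi] [j Hj]] /= e.
  have [i0 j0] : i = 0%N /\ j = 0%N by lia.
  by have /implyP/= := h0 (Ordinal Hi, Ordinal Hj);
    rewrite {1}i0 {1}j0 => /(_ isT)/eqP ->.
case: i Hi e => [|i] Hi e.
  case: j Hj e => [|j] Hj e; first by lia.
  have Hj' : (j < n)%N by apply: ltnW.
  have := IH (Ordinal Hi, Ordinal Hj') ltac:(rewrite /=; lia).
  have := step (Ordinal Hi, Ordinal Hj') (Ordinal Hi, Ordinal Hj).
  by rewrite /adjacent /= !eqxx /= => /(_ isT); lia.
have Hi' : (i < m)%N by apply: ltnW.
have := IH (Ordinal Hi', Ordinal Hj) ltac:(rewrite /=; lia).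
have := step (Ordinal Hi', Ordinal Hj) (Ordinal Hi, Ordinal Hj).
by rewrite /adjacent /= !eqxx /= orbT => /(_ isT); lia.
Qed.

Lemma finite_heights (m n : nat) (P : pred {ffun cell m n -> int}) :
  finite_set [set h : {ffun cell m n -> int} | is_height h && P h]%classic.
Proof.
pose g (f : {ffun cell m n -> 'I_((m + n).*2.+1)}) : {ffun cell m n -> int} :=
  [ffun c => (f c)%:Z - (m + n)%:Z].
apply: (@sub_finite_set _ _ (g @` setT)%classic); last first.
  by apply: finite_image; apply: finite_finset.
move=> h /= /andP[/height_bound hb _].
exists [ffun c => inord (absz (h c + (m + n)%:Z))] => //.
apply/ffunP => c; have := hb c; rewrite !ffunE.
move: (h c) => x hx; rewrite inordK; first by lia.
by rewrite ltnS -addnn; lia.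
Qed.

(* Main.v *)
Require Import Defs.
From mathcomp Require Import all_boot all_order all_algebra.
From mathcomp Require Import finmap mpoly.
From mathcomp Require Import boolp classical_sets functions cardinality.
From mathcomp Require Import polyrcf zify.

Set Implicit Arguments.
Unset Strict Implicit.
Unset Printing Implicit Defensive.

Import Order.TTheory GRing.Theory Num.Theory.
Local Open Scope ring_scope.

(** The step from row [r] to row [r + 1] of a height function is a vector of
    signs.  If two consecutive steps agree, then they are constant vectors
    ([equal_steps_constant]): a sign change inside a step alters a horizontal
    difference by two, which cannot happen twice in a row.  So a function with
    two equal consecutive steps arises from one on a grid with one row less by
    doubling a constant step, which shifts the rows below by a sign.  Doubling
    changes neither the extrema (up to moving them down), nor the number [k] of
    turns (pairs of consecutive steps that differ), nor the number [u] of
    uneven (nonconstant) steps, nor the same two numbers [l], [v] for the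
    columns.  Let [f m n] count the height functions on the m by n grid with
    given values of all these statistics.  There are [m - 1 - u] constant steps
    that can be doubled, and on [m + 1] rows there are [m - 1 - k] pairs of
    equal consecutive steps that can be merged, so

      (m - 1 - u) f(m, n) = (m - 1 - k) f(m + 1, n)

    ([class_count_rec]).  Together with the same recurrence for columns this
    gives, for m > k + 2 and n > l + 2,

      f(m, n) = c C(m - 2 - u, k - u) C(n - 2 - v, l - v)

    with a nonnegative constant [c] ([class_countE]).

    Inside the middle row of a turn, going uphill (downhill) from a vertical
    maximum (minimum) one meets only such cells, so the row contains a strict
    extremum ([turn_extremum]).  Hence [k] and [l] are at most the number [d] of
    extrema, [u <= k + 1], [v <= l + 1], and the remainder is, on large grids, a
    finite sum of the products above: a polynomial.

    For the degree, consider the functions with [d] extrema, [d - 2] row turns,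
    no column turn and no uneven step in either direction: a walk in the row
    index plus a monotone walk in the column index.  All their minima lie on one
    side, so the remainder does not count them.  By the formula above there are
    at least 4 C(m - 2, d - 2) of them, the constant being the number of
    zigzags on the d by 2 grid ([class_base_side]).  With their transposes they
    give

      R(m, n) <= E_d(m, n) - 4 C(m - 2, d - 2) - 4 C(n - 2, d - 2)

    ([remainder_upper_bound]), and the hypothesis on the leading part of the
    polynomial of [E_d] says that the right-hand side has degree at most
    [d - 3] on the diagonal m = n.  As no product in the sum for [R] is
    negative, each of them is bounded by this on the diagonal, so each of them
    has degree at most [d - 3] ([class_degree]); no cancellation of leading
    terms has to be excluded. *)

(** * Row steps and extrema *)

(** Height functions are handled as functions on all pairs of naturals, of
    which only the values on the grid matter: rows can then be inserted,
    deleted and transposed without casts between ordinals. *)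
Definition height (m n : nat) (F : nat -> nat -> int) : Prop :=
  [/\ forall i j, (i.+1 < m)%N -> (j < n)%N -> `|F i.+1 j - F i j| = 1,
      forall i j, (i < m)%N -> (j.+1 < n)%N -> `|F i j.+1 - F i j| = 1
    & F 0%N 0%N = 0].

(** The sign [s] is 1 for a strict minimum and -1 for a strict maximum. *)
Definition strict_ext (s : int) (m n : nat) (F : nat -> nat -> int)
    (i j : nat) : bool :=
  [&& (i.+1 < m)%N ==> (F i.+1 j == F i j + s),
      (0 < i)%N ==> (F i.-1 j == F i j + s),
      (j.+1 < n)%N ==> (F i j.+1 == F i j + s)
    & (0 < j)%N ==> (F i j.-1 == F i j + s)].

Definition num_ext (s : int) (m n : nat) (F : nat -> nat -> int) : nat :=
  (\sum_(i < m) \sum_(j < n) strict_ext s m n F i j)%N.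

Definition minima_within (m n : nat) (F : nat -> nat -> int)
    (P : nat -> nat -> bool) : bool :=
  [forall i : 'I_m, forall j : 'I_n, strict_ext 1 m n F i j ==> P i j].

Definition minima_on_side (m n : nat) (F : nat -> nat -> int) : bool :=
  [|| minima_within m n F (fun i _ => i == 0%N),
      minima_within m n F (fun i _ => i.+1 == m),
      minima_within m n F (fun _ j => j == 0%N)
    | minima_within m n F (fun _ j => j.+1 == n)].

(** A turn between the steps [r] and [r.+1] makes each cell of row [r.+1] where
    they differ a vertical extremum. *)
Definition turn (n : nat) (F : nat -> nat -> int) (r : nat) : bool :=
  [exists j : 'I_n, F r.+2 j - F r.+1 j != F r.+1 j - F r j].

Definition uneven (n : nat) (F : nat -> nat -> int) (r : nat) : bool :=
  [exists j : 'I_n, F r.+1 j - F r j != F r.+1 0%N - F r 0%N].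

Definition num_turn (m n : nat) (F : nat -> nat -> int) : nat :=
  (\sum_(r < m.-2) turn n F r)%N.

Definition num_uneven (m n : nat) (F : nat -> nat -> int) : nat :=
  (\sum_(r < m.-1) uneven n F r)%N.

Definition transp (T : Type) (F : nat -> nat -> T) : nat -> nat -> T :=
  fun i j => F j i.

Lemma height_transp m n F : height m n F -> height n m (transp F).
Proof. by case=> hr hc h0; split=> // i j hi hj; [exact: hc | exact: hr]. Qed.

Lemma strict_ext_transp s m n F i j :
  strict_ext s n m (transp F) j i = strict_ext s m n F i j.
Proof.
rewrite /strict_ext /transp.
by do 4!case: (_ ==> _).
Qed.

Lemma num_ext_transp s m n F : num_ext s n m (transp F) = num_ext s m n F.
Proof.
rewrite /num_ext exchange_big; apply: eq_bigr => i _; apply: eq_bigr => j _.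
by rewrite strict_ext_transp.
Qed.

Lemma minima_within_transp m n F P :
  minima_within n m (transp F) (transp P) = minima_within m n F P.
Proof.
apply/'forall_forallP/'forall_forallP => H i j; have := H j i;
by rewrite strict_ext_transp.
Qed.

Lemma minima_on_side_transp m n F :
  minima_on_side n m (transp F) = minima_on_side m n F.
Proof.
rewrite /minima_on_side.
rewrite -(minima_within_transp m n F (fun i _ => i == 0%N)).
rewrite -(minima_within_transp m n F (fun i _ => i.+1 == m)).
rewrite -(minima_within_transp m n F (fun _ j => j == 0%N)).
rewrite -(minima_within_transp m n F (fun _ j => j.+1 == n)).
by rewrite /transp; do 4!case: (minima_within _ _ _ _).
Qed.

(** In the middle row of a turn, let [V] be the set of cells whose two vertical
    neighbours exceed them by [s].  A horizontal neighbour of a cell of [V]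
    that differs from it by [- s] lies again in [V], because the values above
    and below it have no other choice.  So a cell of [V] that is the most
    extreme one in [V] is a strict extremum of the grid. *)
Lemma turn_extremum m n F r : height m n F -> (r.+2 < m)%N -> turn n F r ->
  exists s (j : 'I_n), (s = 1 \/ s = -1) /\ strict_ext s m n F r.+1 j.
Proof.
case=> hr hc _ hm /existsP[j0 hj0].
pose V s (j : 'I_n) := (F r.+2 j == F r.+1 j + s) && (F r j == F r.+1 j + s).
have [s hs Vj0] : exists2 s, s = 1 \/ s = -1 & V s j0.
  have h1 := hr r j0 (ltnW hm) (ltn_ord j0).
  have h2 := hr r.+1 j0 hm (ltn_ord j0).
  exists (F r j0 - F r.+1 j0); first lia.
  by rewrite /V; lia.
case: (arg_minP (fun j : 'I_n => s * F r.+1 j) Vj0) => j /andP[/eqP Vj Vj'] jmin.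
exists s, j; split=> //; rewrite /strict_ext hm Vj Vj' eqxx /=.
have hn := ltn_ord j.
(* The minimality of [j] in [V] leaves its neighbours only one value. *)
have step (k : 'I_n) : `|F r.+1 k - F r.+1 j| = 1 -> `|F r k - F r j| = 1 ->
    `|F r.+2 k - F r.+2 j| = 1 -> F r.+1 k == F r.+1 j + s.
  move=> h1 h0 h2.
  have hk0 := hr r k (ltnW hm) (ltn_ord k).
  have hk1 := hr r.+1 k hm (ltn_ord k).
  have := jmin k; rewrite /V.
  by case: hs => hs; subst s; lia.
apply/andP; split; apply/implyP => hj.
  have := step (Ordinal hj) => /=; apply; apply: hc => //; lia.
have hj' : (j.-1 < n)%N by lia.
have := step (Ordinal hj') => /=.
have e : j = j.-1.+1 :> nat by lia.
have := hc r j.-1; have := hc r.+1 j.-1; have := hc r.+2 j.-1.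
rewrite -e => h2 h1 h0; move=> H; apply: H.
- by rewrite distrC; apply: h1 => //; lia.
- by rewrite distrC; apply: h0 => //; lia.
by rewrite distrC; apply: h2 => //; lia.
Qed.

Lemma num_turn_le m n F : height m n F ->
  (num_turn m n F <= num_ext 1 m n F + num_ext (-1) m n F)%N.
Proof.
move=> hF; case: m hF => [|[|m]] hF; rewrite /num_turn ?big_ord0 //=.
rewrite /num_ext -big_split /= big_ord_recl big_ord_recr /=.
apply: leq_trans (leq_addl _ _); apply: leq_trans (leq_addr _ _).
apply: leq_sum => r _; case ht: turn => //.
have [|s [j [hs hj]]] := turn_extremum hF _ ht; first by rewrite !ltnS.
rewrite (bigD1 j) //= [X in (_ + X)%N](bigD1 j) //= /bump /= add1n.
by case: hs => hs; rewrite -hs hj; lia.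
Qed.

(** If the step changes between columns [j] and [j.+1], it alters the horizontal
    difference there by two; doing so twice would take it out of {-1, 1}. *)
Lemma equal_steps_constant m n F r : height m n F -> (r.+2 < m)%N ->
  ~~ turn n F r -> ~~ uneven n F r.
Proof.
case=> hr hc _ hm /existsPn ht; apply/existsPn.
suff H : forall j, (j < n)%N -> F r.+1 j - F r j == F r.+1 0%N - F r 0%N.
  by move=> j; rewrite negbK; apply: H; apply: ltn_ord.
elim=> [|j IH] hj; first by rewrite eqxx.
have := IH (ltnW hj).
have := ht (Ordinal hj); have := ht (Ordinal (ltnW hj)); rewrite !negbK /=.
have := hc r j (ltnW (ltnW hm)) hj.
have := hc r.+1 j (ltnW hm) hj.
have := hc r.+2 j hm hj.
lia.
Qed.

(** Each uneven step except perhaps the last one is followed by a turn. *)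
Lemma num_uneven_le m n F : height m n F ->
  (num_uneven m n F <= (num_turn m n F).+1)%N.
Proof.
move=> hF; case: m hF => [|[|m]] hF; rewrite /num_uneven /num_turn ?big_ord0 //=.
rewrite big_ord_recr /= -addn1; apply: leq_add; last by case: uneven.
apply: leq_sum => r _.
have := equal_steps_constant (r := r) hF; rewrite !ltnS => /(_ (ltn_ord r)).
by case: turn => //=; [case: uneven | move=> /(_ isT)/negbTE ->].
Qed.

(** * Doubling a constant step *)

(** [G] on [m.+1] rows arises from [F] on [m] rows by doubling the step from row
    [i], which is constant of value [e].  A relation, and not an operation on
    functions, so that it serves for insertion and for deletion alike. *)
Definition doubled_step (m n i : nat) (F G : nat -> nat -> int) : Prop :=
  exists e : int,
    [/\ forall j, (j < n)%N -> F i.+1 j = F i j + e,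
        forall r j, (r <= i)%N -> (j < n)%N -> G r j = F r j
      & forall r j, (i <= r)%N -> (r < m)%N -> (j < n)%N ->
          G r.+1 j = F r j + e].

(** [bump] renumbers the old rows around an inserted row [i]. *)
Lemma sum_bump m i (f g : nat -> nat) : (i < m.+1)%N ->
  (forall r, (r < m)%N -> f (bump i r) = g r) ->
  (\sum_(r < m.+1) f r = f i + \sum_(r < m) g r)%N.
Proof.
move=> hi H; rewrite (bigD1_ord (Ordinal hi)) //=; congr (_ + _)%N.
by apply: eq_bigr => r _; apply: H.
Qed.

Section Doubling.

Variables (m n i : nat) (F G : nat -> nat -> int).
Hypotheses (hi : (i.+1 < m)%N) (hn : (0 < n)%N).
Hypothesis hFG : doubled_step m n i F G.

Lemma doubled_step_height : height m n F <-> height m.+1 n G.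
Proof.
case: hFG => e [hF hlo hhi]; split; case=> hr hc h0; split.
- move=> r j hrm hj; case: (ltngtP r i) => hri.
  + by rewrite !hlo ?(ltnW hri) //; apply: hr => //; lia.
  + have e1 : r = r.-1.+1 by lia.
    rewrite hhi // ?(ltnW hri) //.
    rewrite e1 hhi //; try lia.
    by have := hr r.-1 j; lia.
  + rewrite hri hhi ?hlo //; last by lia.
    by have := hr i j hi hj; rewrite hF //; lia.
- move=> r j hrm hj; case: (leqP r i) => hri.
  + by rewrite !hlo ?(ltnW hj) //; apply: hc => //; lia.
  + have e1 : r = r.-1.+1 by lia.
    rewrite e1 !hhi //; try lia.
    by have := hc r.-1 j; lia.
- by rewrite hlo.
- move=> r j hrm hj; case: (leqP i r) => hri.
  + by have := hr r.+1 j; rewrite !hhi //; try lia; move=> /(_ hrm hj); lia.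
  + by have := hr r j; rewrite !hlo //; try lia; apply=> //; lia.
- move=> r j hrm hj; case: (leqP i r) => hri.
  + by have := hc r.+1 j; rewrite !hhi //; try lia; move=> /(_ hrm hj); lia.
  + by have := hc r j; rewrite !hlo //; try lia; apply=> //; lia.
- by rewrite -hlo.
Qed.

Lemma doubled_step_bump r j : (r < m)%N -> (j < n)%N ->
  exists e', forall k, (k < n)%N -> G (bump i.+1 r) k = F r k + e'.
Proof.
case: hFG => e [hF hlo hhi] hr hj; rewrite /bump.
by case: (ltnP i r) => hir; [exists e | exists 0] => k hk;
  rewrite ?add1n ?add0n ?hhi ?hlo ?addr0 // ltnW.
Qed.

Lemma strict_ext_bump (s : int) r j : (r < m)%N -> (j < n)%N ->
  strict_ext s m.+1 n G (bump i.+1 r) j = strict_ext s m n F r j.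
Proof.
case: hFG => e [hF hlo hhi] hr hj.
have [e' he] := doubled_step_bump hr hj.
rewrite /strict_ext he //.
congr [&& _, _, _ & _].
- rewrite /bump; case: (ltnP i r) => hir; rewrite ?add1n ?add0n.
    rewrite ltnS; case: ltnP => //= hrm; have := he j hj.
    rewrite /bump hir add1n !hhi //; try lia.
  have := he j hj; rewrite /bump leqNgt ltnS hir add0n hlo // => e1.
  case: (ltngtP r i) hir => // [hri|hri] _.
    by rewrite hlo // (_ : (_ < m.+1)%N = (r.+1 < m)%N) //; lia.
  rewrite hri hhi // -?hF // ?(ltnW hi) //.
  by rewrite ltnS ltnW // hi /=; lia.
- rewrite /bump; case: (ltnP i r) => hir; rewrite ?add1n ?add0n.
    have hG : G r j = F r.-1 j + e.
      by rewrite {1}(_ : r = r.-1.+1) ?hhi //; lia.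
    by have := he j hj; rewrite /bump hir add1n hhi //= ?hG; lia.
  case: r hr he hir => //= r hr he hir.
  rewrite hlo //; last by lia.
  by have := he j hj; rewrite /bump leqNgt ltnS hir add0n hlo //; lia.
- by case: ltnP => //= hj1; rewrite he //; lia.
- by case: j hj => //= j hj; rewrite he //; lia.
Qed.

(** The inserted row lies strictly between its two vertical neighbours. *)
Lemma strict_ext_new (s : int) j : s != 0 -> (j < n)%N ->
  strict_ext s m.+1 n G i.+1 j = false.
Proof.
case: hFG => e [hF hlo hhi] hs hj; rewrite /strict_ext ltnS hi /=.
apply/negbTE/negP => /and4P[/eqP h1 /eqP h2 _ _]; move: h1 h2.
by rewrite !hhi ?hlo ?hF //; lia.
Qed.

Lemma num_ext_doubled (s : int) :
  s != 0 -> num_ext s m.+1 n G = num_ext s m n F.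
Proof.
move=> hs; rewrite /num_ext.
pose f r := (\sum_(j < n) strict_ext s m.+1 n G r j)%N.
pose g r := (\sum_(j < n) strict_ext s m n F r j)%N.
rewrite -/(f _) (@sum_bump m i.+1 f g) ?ltnS ?(ltnW hi) //.
  by rewrite /f big1 // => j _; rewrite strict_ext_new.
by move=> r hr; apply: eq_bigr => j _; rewrite strict_ext_bump.
Qed.

Lemma minima_within_doubled (P Q : nat -> nat -> bool) :
  (forall r j, (r < m)%N -> Q (bump i.+1 r) j = P r j) ->
  minima_within m.+1 n G Q = minima_within m n F P.
Proof.
move=> hPQ; apply/'forall_forallP/'forall_forallP => H r j.
  have hb : (bump i.+1 r < m.+1)%N by rewrite /bump; have := ltn_ord r; lia.
  have := H (Ordinal hb) j => /=; rewrite strict_ext_bump ?hPQ //.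
case: (eqVneq (r : nat) i.+1) => [->|hri]; first by rewrite strict_ext_new.
have hu : (unbump i.+1 r < m)%N by rewrite /unbump; have := ltn_ord r; lia.
have := H (Ordinal hu) j => /=.
by rewrite -strict_ext_bump // -hPQ // unbumpK.
Qed.

Lemma minima_on_side_doubled :
  minima_on_side m.+1 n G = minima_on_side m n F.
Proof.
congr [|| _, _, _ | _]; apply: minima_within_doubled => r j hr //;
by rewrite /bump; lia.
Qed.

Lemma doubled_step_diff r : (r.+1 < m)%N -> forall j, (j < n)%N ->
  G (bump i.+1 r).+1 j - G (bump i.+1 r) j = F r.+1 j - F r j.
Proof.
case: hFG => e [hF hlo hhi] hr j hj; rewrite /bump.
case: (ltnP i r) => hir; rewrite ?add1n ?add0n.
  by rewrite !hhi //; lia.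
case: (ltngtP r i) hir => // [hri|hri] _; first by rewrite !hlo //; lia.
by rewrite hri hhi ?hlo ?hF //; lia.
Qed.

Lemma doubled_step_diff_new j : (j < n)%N ->
  G i.+2 j - G i.+1 j = F i.+1 j - F i j.
Proof.
by case: hFG => e [hF hlo hhi] hj; rewrite !hhi //; lia.
Qed.

Lemma num_uneven_doubled : num_uneven m.+1 n G = num_uneven m n F.
Proof.
rewrite /num_uneven.
case: m hi doubled_step_diff doubled_step_diff_new => // m' hi' hd hdn.
rewrite (@sum_bump m' i.+1 (fun r => uneven n G r) (fun r => uneven n F r)) //.
  suff -> : uneven n G i.+1 = false by [].
  apply/negbTE/existsPn => j; rewrite negbK !hdn //.
  by case: hFG => e [hF _ _]; rewrite !hF //; lia.
move=> r hr; congr (nat_of_bool _).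
by apply: eq_existsb => j; rewrite !hd // ltnS.
Qed.

Lemma num_turn_doubled : num_turn m.+1 n G = num_turn m n F.
Proof.
rewrite /num_turn; case: m hi hFG => [|[|m']] // hi' hFG' /=.
case: (hFG') => e [hF hlo hhi].
rewrite (@sum_bump m' i (fun r => turn n G r) (fun r => turn n F r)) //.
  suff -> : turn n G i = false by [].
  apply/negbTE/existsPn => j; rewrite negbK.
  have hj := ltn_ord j.
  by rewrite !hhi // ?hlo // ?hF //; lia.
move=> r hr; congr (nat_of_bool _).
apply: eq_existsb => j; have hj := ltn_ord j; rewrite /bump.
case: (leqP i r) => hir; rewrite ?add1n ?add0n.
  by rewrite !hhi //; lia.
case: (ltngtP r.+1 i) hir => // [hri|hri] _.
  by rewrite !hlo //; lia.
have h := hF j hj; have h' := hhi i j (leqnn i) (ltnW hi') hj.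
by rewrite -hri in h h'; rewrite h h' !hlo -?hri //; lia.
Qed.

(** Every row of [G] is a translate of a row of [F] and conversely; this is why
    the column statistics, which only see horizontal differences, persist. *)
Lemma doubled_rows_ex (Q : (nat -> int) -> bool) :
  (forall x y e, (forall j, (j < n)%N -> x j = y j + e) -> Q x = Q y) ->
  [exists r : 'I_m.+1, Q (G r)] = [exists r : 'I_m, Q (F r)].
Proof.
move=> hQ; apply/existsP/existsP => [[r hr]|[r hr]]; last first.
  have hb : (bump i.+1 r < m.+1)%N by rewrite /bump; have := ltn_ord r; lia.
  exists (Ordinal hb) => /=.
  have [e' he] := doubled_step_bump (ltn_ord r) hn.
  by rewrite (hQ _ _ _ he).
case: hFG => e [hF hlo hhi].
case: (eqVneq (r : nat) i.+1) => [hri|hri].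
  have h : (i < m)%N by lia.
  exists (Ordinal h) => /=; rewrite -(hQ (G r) _ e) // => j hj.
  by rewrite hri hhi.
have hu : (unbump i.+1 r < m)%N by rewrite /unbump; have := ltn_ord r; lia.
exists (Ordinal hu) => /=.
have [e' he] := doubled_step_bump hu hn.
by move: he; rewrite unbumpK // => he; rewrite -(hQ _ _ _ he).
Qed.

Lemma num_turn_transp_doubled :
  num_turn n m.+1 (transp G) = num_turn n m (transp F).
Proof.
rewrite /num_turn; apply: eq_bigr => j _; congr (nat_of_bool _).
have hj := ltn_ord j.
apply: (@doubled_rows_ex (fun x => x j.+2 - x j.+1 != x j.+1 - x j)) => x y e h.
by rewrite !h; lia.
Qed.

Lemma num_uneven_transp_doubled :
  num_uneven n m.+1 (transp G) = num_uneven n m (transp F).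
Proof.
rewrite /num_uneven; apply: eq_bigr => j _; congr (nat_of_bool _).
have hj := ltn_ord j.
have h0 k : (k < n)%N -> G 0%N k = F 0%N k.
  by case: hFG => e [_ hlo _] hk; rewrite hlo.
rewrite /uneven /transp !h0 //; try lia.
apply: (@doubled_rows_ex (fun x => x j.+1 - x j != _)) => x y e h.
by rewrite !h; lia.
Qed.

End Doubling.

(** * Counting height functions *)

Definition of_grid (m n : nat) (h : {ffun cell m n -> int}) (i j : nat) : int :=
  if insub i is Some i' then
    if insub j is Some j' then h (i', j') else 0
  else 0.

Definition to_grid (m n : nat) (F : nat -> nat -> int) :
    {ffun cell m n -> int} :=
  [ffun c : cell m n => F c.1 c.2].

Lemma of_gridE m n (h : {ffun cell m n -> int}) (i : 'I_m) (j : 'I_n) :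
  of_grid h i j = h (i, j).
Proof. by rewrite /of_grid !valK. Qed.

Lemma to_gridK m n F i j : (i < m)%N -> (j < n)%N ->
  of_grid (to_grid m n F) i j = F i j.
Proof. by move=> hi hj; rewrite (of_gridE _ (Ordinal hi) (Ordinal hj)) ffunE. Qed.

Lemma is_heightP m n (h : {ffun cell m n -> int}) :
  reflect (height m n (of_grid h)) (is_height h).
Proof.
apply: (iffP andP) => [[/'forall_forallP H1 /forallP H2]|[hr hc h0]]; split.
- move=> i j hi hj.
  have /implyP := H1 (Ordinal (ltnW hi), Ordinal hj) (Ordinal hi, Ordinal hj).
  rewrite /adjacent /= !eqxx orbT distrC -!of_gridE /=.
  by move=> /(_ isT)/eqP.
- move=> i j hi hj.
  have /implyP := H1 (Ordinal hi, Ordinal (ltnW hj)) (Ordinal hi, Ordinal hj).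
  rewrite /adjacent /= !eqxx distrC -!of_gridE /=.
  by move=> /(_ isT)/eqP.
- rewrite /of_grid; case: insubP => // i _ hi; case: insubP => // j _ hj.
  by have /implyP := H2 (i, j); rewrite /= hi hj => /(_ isT)/eqP.
- apply/'forall_forallP => -[i j] [i' j']; rewrite /adjacent /= -!of_gridE.
  apply/implyP => /orP[] /andP[/eqP <-] /orP[] /eqP e; apply/eqP.
  + by rewrite -e distrC; apply: hc; rewrite ?e.
  + by rewrite -e; apply: hc; rewrite ?e.
  + by rewrite -e distrC; apply: hr; rewrite ?e.
  + by rewrite -e; apply: hr; rewrite ?e.
- apply/forallP => -[i j]; rewrite -of_gridE /=.
  by apply/implyP => /andP[/eqP -> /eqP ->]; apply/eqP.
Qed.

Lemma grid_extremum m n (h : {ffun cell m n -> int}) s (i : 'I_m) (j : 'I_n) :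
  [forall v, adjacent (i, j) v ==> (h v == h (i, j) + s)] =
  strict_ext s m n (of_grid h) i j.
Proof.
apply/forallP/and4P => [H|[H1 H2 H3 H4] [i' j']].
- split; apply/implyP => hk.
  + have /implyP := H (Ordinal hk, j); rewrite -!of_gridE; apply.
    by rewrite /adjacent /= !eqxx orbT.
  + have hi : (i.-1 < m)%N by have := ltn_ord i; lia.
    have /implyP := H (Ordinal hi, j); rewrite -!of_gridE; apply.
    by rewrite /adjacent /= prednK // !eqxx !orbT.
  + have /implyP := H (i, Ordinal hk); rewrite -!of_gridE; apply.
    by rewrite /adjacent /= !eqxx.
  + have hj : (j.-1 < n)%N by have := ltn_ord j; lia.
    have /implyP := H (i, Ordinal hj); rewrite -!of_gridE; apply.
    by rewrite /adjacent /= prednK // !eqxx !orbT.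
- apply/implyP; rewrite /adjacent /= -!of_gridE.
  move=> /orP[] /andP[/eqP <-] /orP[] /eqP e.
  + by move/implyP: H3; rewrite e; apply.
  + by move/implyP: H4; rewrite -e /=; apply.
  + by move/implyP: H1; rewrite e; apply.
  + by move/implyP: H2; rewrite -e /=; apply.
Qed.

Lemma card_cells m n (A : {set cell m n}) (P : nat -> nat -> bool) :
  (forall (i : 'I_m) (j : 'I_n), ((i, j) \in A) = P i j) ->
  #|A| = (\sum_(i < m) \sum_(j < n) P i j)%N.
Proof.
move=> hA; rewrite pair_big /= -sum1_card big_mkcond /=.
by apply: eq_bigr => -[i j] _; rewrite hA; case: (P i j).
Qed.

Lemma card_local_minima m n (h : {ffun cell m n -> int}) :
  #|local_minima h| = num_ext 1 m n (of_grid h).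
Proof. by apply: card_cells => i j; rewrite inE grid_extremum. Qed.

Lemma card_local_maxima m n (h : {ffun cell m n -> int}) :
  #|local_maxima h| = num_ext (-1) m n (of_grid h).
Proof. by apply: card_cells => i j; rewrite inE grid_extremum. Qed.

Lemma on_single_sideE m n (h : {ffun cell m n -> int}) :
  on_single_side (local_minima h) = minima_on_side m n (of_grid h).
Proof.
have H (S : {set cell m n}) (P : nat -> nat -> bool) :
    (forall (i : 'I_m) (j : 'I_n), ((i, j) \in S) = P i j) ->
    (local_minima h \subset S) = minima_within m n (of_grid h) P.
  move=> hS; apply/fintype.subsetP/'forall_forallP => [sub i j|sub [i j]].
    by apply/implyP => hij; rewrite -hS; apply: sub; rewrite inE grid_extremum.
  by rewrite inE grid_extremum hS => hij; have /implyP := sub i j; apply.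
rewrite /on_single_side /= orbF /minima_on_side.
by congr [|| _, _, _ | _]; apply: H => i j; rewrite inE.
Qed.

(** With two rows every cell has a neighbour, so it cannot be both a minimum and
    a maximum. *)
Lemma card_extrema m n (h : {ffun cell m n -> int}) : (1 < m)%N ->
  #|extrema h| =
  (num_ext 1 m n (of_grid h) + num_ext (-1) m n (of_grid h))%N.
Proof.
move=> hm; rewrite -card_local_minima -card_local_maxima /extrema.
rewrite cardsU (_ : _ :&: _ = finset.set0) ?cards0 ?subn0 //.
apply/setP => -[i j]; rewrite !inE !grid_extremum; apply/negbTE/negP.
case/andP => /and4P[a1 a2 _ _] /and4P[b1 b2 _ _].
case: (posnP i) => hi.
  have h1 : (i.+1 < m)%N by rewrite hi.
  by move: a1 b1; rewrite h1; lia.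
by move: a2 b2; rewrite hi; lia.
Qed.

(** The conjunct [true] brings the set into the shape for which
    [finite_heights] gives finiteness. *)
Definition heights m n : seq {ffun cell m n -> int} :=
  enum_fset (fset_set
    [set h : {ffun cell m n -> int} | is_height h && true]%classic).

Lemma mem_heights m n h : (h \in heights m n) = is_height h.
Proof.
rewrite in_fset_set; last exact: (finite_heights (fun _ => true)).
by apply/idP/idP; rewrite in_setE /= andbT.
Qed.

Definition count_heights m n (P : (nat -> nat -> int) -> bool) : nat :=
  count (fun h => P (of_grid h)) (heights m n).

Lemma num_heightsE m n (P : pred {ffun cell m n -> int}) Q :
  (forall h, P h = Q (of_grid h)) -> num_heights P = count_heights m n Q.
Proof.
move=> hPQ; rewrite /num_heights /count_heights -size_filter.
apply: perm_size; apply: uniq_perm; rewrite ?fset_uniq ?filter_uniq ?fset_uniq //.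
move=> h; rewrite mem_filter mem_heights in_fset_set; last exact: finite_heights.
rewrite -hPQ andbC.
by apply/idP/idP; rewrite in_setE.
Qed.

Definition agree m n (F G : nat -> nat -> int) : Prop :=
  forall i j, (i < m)%N -> (j < n)%N -> F i j = G i j.

Lemma count_heights_leq m n m' n' (P Q : (nat -> nat -> int) -> bool)
    (f : (nat -> nat -> int) -> nat -> nat -> int) :
  (forall F G, height m n F -> P F -> agree m' n' G (f F) ->
    height m' n' G /\ Q G) ->
  (forall F F', height m n F -> P F -> height m n F' -> P F' ->
    agree m' n' (f F) (f F') -> agree m n F F') ->
  (count_heights m n P <= count_heights m' n' Q)%N.
Proof.
move=> hf finj; rewrite /count_heights -!size_filter.
pose g (h : {ffun cell m n -> int}) := to_grid m' n' (f (of_grid h)).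
rewrite -(size_map g); apply: uniq_leq_size.
  rewrite map_inj_in_uniq ?filter_uniq ?fset_uniq // => h h'.
  rewrite !mem_filter !mem_heights => /andP[Ph /is_heightP hh].
  case/andP=> Ph' /is_heightP hh' e; apply/ffunP => -[i j].
  rewrite -!of_gridE; apply: finj => // i' j' hi' hj'.
  by rewrite -(to_gridK _ hi' hj') -[RHS](to_gridK _ hi' hj') -/(g h) e.
move=> x /mapP[h]; rewrite mem_filter mem_heights => /andP[Ph /is_heightP hh] ->.
rewrite mem_filter mem_heights.
have [|h1 h2] := hf (of_grid h) (of_grid (g h)) hh Ph.
  by move=> i j hi hj; rewrite to_gridK.
by rewrite h2; apply/is_heightP.
Qed.

Lemma eq_count_heights m n (P Q : (nat -> nat -> int) -> bool) :
  (forall F, height m n F -> P F = Q F) ->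
  count_heights m n P = count_heights m n Q.
Proof.
move=> hPQ; apply: eq_in_count => h; rewrite mem_heights => /is_heightP.
exact: hPQ.
Qed.

Lemma sub_count_heights m n (P Q : (nat -> nat -> int) -> bool) :
  (forall F, height m n F -> P F -> Q F) ->
  (count_heights m n P <= count_heights m n Q)%N.
Proof.
move=> hPQ; rewrite /count_heights -!size_filter; apply: uniq_leq_size.
  by rewrite filter_uniq ?fset_uniq.
move=> h; rewrite !mem_filter mem_heights => /andP[Ph hh]; rewrite hh andbT.
by apply: hPQ => //; apply/is_heightP.
Qed.

Lemma count_heights_disjoint m n (P Q : (nat -> nat -> int) -> bool) :
  (forall F, height m n F -> P F -> ~~ Q F) ->
  (count_heights m n P + count_heights m n Q)%N =
  count_heights m n (fun F => P F || Q F).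
Proof.
move=> hPQ; rewrite /count_heights -count_predUI.
rewrite [X in (_ + X)%N](_ : _ = 0%N) ?addn0 //.
apply/eqP; rewrite -leqn0 leqNgt -has_count; apply/hasPn => h.
rewrite mem_heights => /is_heightP hh /=; apply/negP => /andP[h1 h2].
by have := hPQ _ hh h1; rewrite h2.
Qed.

Lemma count_heights_partition m n (P : (nat -> nat -> int) -> bool)
    (f : (nat -> nat -> int) -> nat) D :
  (forall F, height m n F -> P F -> (f F < D)%N) ->
  count_heights m n P =
  (\sum_(x < D) count_heights m n (fun F => P F && (f F == x)))%N.
Proof.
move=> hf; rewrite /count_heights -sum1_count big_mkcond /= big_seq.
under [RHS]eq_bigr do rewrite -sum1_count big_mkcond /= big_seq.
rewrite exchange_big /=; apply: eq_bigr => h.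
rewrite mem_heights => /is_heightP hh.
case Ph: (P (of_grid h)) => /=; last by rewrite big1.
rewrite (bigD1 (Ordinal (hf _ hh Ph))) //= eqxx big1 // => x hx.
by case: eqP => // e; case/eqP: hx; apply: val_inj.
Qed.

Lemma sum_count_heights m n (P : (nat -> nat -> int) -> bool) N c
    (b : (nat -> nat -> int) -> nat -> bool) :
  (forall F, height m n F -> P F -> (\sum_(i < N) ~~ b F i)%N = c) ->
  (\sum_(i < N) count_heights m n (fun F => P F && ~~ b F i))%N =
  (c * count_heights m n P)%N.
Proof.
move=> hc; rewrite /count_heights -sum1_count big_distrr /= [RHS]big_mkcond.
rewrite [RHS]big_seq.
under [LHS]eq_bigr do rewrite -sum1_count big_mkcond /= big_seq.
rewrite exchange_big /=; apply: eq_bigr => h.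
rewrite mem_heights => /is_heightP hh.
case Ph: (P (of_grid h)) => /=; last by rewrite big1.
by rewrite muln1 -(hc _ hh Ph); apply: eq_bigr => i _; case: (b _ _).
Qed.

(** * The recurrence in the number of rows *)

(** The predicate [T] selects the admissible numbers of minima and maxima and
    whether the minima may lie on one side; [k], [u] are the row statistics and
    [l], [v] the column statistics. *)
Definition in_class (T : nat -> nat -> bool -> bool) (k u l v m n : nat)
    (F : nat -> nat -> int) : bool :=
  [&& T (num_ext 1 m n F) (num_ext (-1) m n F) (minima_on_side m n F),
      num_turn m n F == k, num_uneven m n F == u,
      num_turn n m (transp F) == l & num_uneven n m (transp F) == v].

Definition class_count T k u l v m n : nat :=
  count_heights m n (in_class T k u l v m n).

Lemma in_class_doubled T k u l v m n i F G : (i.+1 < m)%N -> (0 < n)%N ->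
  doubled_step m n i F G ->
  in_class T k u l v m.+1 n G = in_class T k u l v m n F.
Proof.
move=> hi hn hFG; rewrite /in_class !(num_ext_doubled hi hn hFG) //.
rewrite (minima_on_side_doubled hi hn hFG) (num_turn_doubled hi hn hFG).
rewrite (num_uneven_doubled hi hn hFG) (num_turn_transp_doubled hi hn hFG).
by rewrite (num_uneven_transp_doubled hi hn hFG).
Qed.

Lemma in_class_transp T k u l v m n F :
  in_class T l v k u n m (transp F) = in_class T k u l v m n F.
Proof.
rewrite /in_class !(num_ext_transp _ m n F) minima_on_side_transp.
congr (_ && _).
rewrite -[transp (transp F)]/F.
by do 4!case: eqP.
Qed.

Lemma class_count_transp T k u l v m n :
  class_count T k u l v m n = class_count T l v k u n m.
Proof.
suff H k' u' l' v' m' n' :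
    (class_count T k' u' l' v' m' n' <= class_count T l' v' k' u' n' m')%N.
  by apply/eqP; rewrite eqn_leq !H.
pose f (h : {ffun cell m' n' -> int}) := to_grid n' m' (transp (of_grid h)).
have hf h : of_grid (f h) = transp (of_grid h).
  apply/funext => i; apply/funext => j.
  rewrite /of_grid /transp.
  case: (insubP _ i) => [i' _ _|_]; case: (insubP _ j) => [j' _ _|_] //.
  by rewrite ffunE /= -of_gridE.
rewrite /class_count /count_heights -!size_filter -(size_map f).
apply: uniq_leq_size.
  rewrite map_inj_in_uniq ?filter_uniq ?fset_uniq // => h h' _ _ e.
  apply/ffunP => -[i j]; rewrite -!of_gridE.
  by rewrite -[of_grid h _ _]/(transp (of_grid h) _ _) -hf e hf.
move=> x /mapP[h]; rewrite mem_filter mem_heights => /andP[Ph /is_heightP hh] ->.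
rewrite mem_filter mem_heights hf in_class_transp Ph.
by apply/is_heightP; rewrite hf; apply: height_transp.
Qed.

Definition double (i : nat) (F : nat -> nat -> int) (r j : nat) : int :=
  if (r <= i)%N then F r j else F r.-1 j + (F i.+1 0%N - F i 0%N).

Definition undouble (i : nat) (F : nat -> nat -> int) (r j : nat) : int :=
  if (r <= i)%N then F r j else F r.+1 j - (F i.+1 0%N - F i 0%N).

Lemma doubled_step_double m n i F G : (i.+1 < m)%N -> ~~ uneven n F i ->
  agree m.+1 n G (double i F) -> doubled_step m n i F G.
Proof.
move=> hi /existsPn hF hG; exists (F i.+1 0%N - F i 0%N); split.
- by move=> j hj; have := hF (Ordinal hj); rewrite negbK /= => /eqP <-; lia.
- by move=> r j hr hj; rewrite hG ?/double ?hr //; lia.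
- by move=> r j hr hrm hj; rewrite hG // /double ltnNge hr.
Qed.

(** Deleting a row between two equal steps is licit because equal consecutive
    steps are constant. *)
Lemma doubled_step_undouble m n i F G : height m.+1 n F -> (i.+1 < m)%N ->
  ~~ turn n F i -> agree m n G (undouble i F) -> doubled_step m n i G F.
Proof.
move=> hh hi ht hG.
have hu : ~~ uneven n F i by apply: (equal_steps_constant hh).
move/existsPn: ht => ht; move/existsPn: hu => hu.
exists (F i.+1 0%N - F i 0%N); split.
- move=> j hj; rewrite !hG //; last by lia.
  rewrite /undouble ltnn leqnn.
  have := hu (Ordinal hj); have := ht (Ordinal hj); rewrite !negbK /=.
  by move=> /eqP e1 /eqP e2; lia.
- by move=> r j hr hj; rewrite hG ?/undouble ?hr //; lia.
- move=> r j hr hrm hj; rewrite hG // /undouble.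
  case: (ltngtP r i) hr => // [hri|->] _; first by lia.
  by have := hu (Ordinal hj); rewrite negbK /= => /eqP <-; lia.
Qed.

Lemma class_count_double T k u l v m n i : (i.+1 < m)%N -> (0 < n)%N ->
  count_heights m n (fun F => in_class T k u l v m n F && ~~ uneven n F i) =
  count_heights m.+1 n
    (fun F => in_class T k u l v m.+1 n F && ~~ turn n F i).
Proof.
move=> hi hn; apply/eqP; rewrite eqn_leq; apply/andP; split.
- apply: (count_heights_leq (f := double i)).
  + move=> F G hF /andP[cF uF] hG.
    have hFG := doubled_step_double hi uF hG.
    split; first by apply/(doubled_step_height hi hn hFG).
    rewrite (in_class_doubled T k u l v hi hn hFG) cF /=.
    apply/existsPn => j; rewrite negbK.
    case: hFG => e [h1 h2 h3]; have hj := ltn_ord j.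
    by rewrite !h3 ?h2 ?h1 //; lia.
  + move=> F F' hF /andP[_ uF] hF' /andP[_ uF'] H.
    have [|e [_ a2 a3]] := doubled_step_double hi uF (G := double i F).
      by [].
    have [|e' [_ b2 b3]] := doubled_step_double hi uF' (G := double i F').
      by [].
    have ee : e = e'.
      have := a2 i 0%N; have := b2 i 0%N; have := a3 i 0%N; have := b3 i 0%N.
      have := H i 0%N; have := H i.+1 0%N.
      by move=> /(_ (ltnW hi) hn) -> /(_ _ hn) ->; lia.
    move=> r j hr hj; case: (leqP r i) => hri.
      by rewrite -a2 // -b2 // H //; lia.
    have := a3 r j (ltnW hri) hr hj; rewrite H // b3 ?(ltnW hri) //; lia.
- apply: (count_heights_leq (f := undouble i)).
  + move=> F G hF /andP[cF uF] hG.
    have hFG := doubled_step_undouble hF hi uF hG.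
    split; first by apply/(doubled_step_height hi hn hFG).
    rewrite -(in_class_doubled T k u l v hi hn hFG) cF /=.
    apply/existsPn => j; rewrite negbK.
    by case: hFG => e [h1 h2 h3]; rewrite !h1 //; lia.
  + move=> F F' hF /andP[_ tF] hF' /andP[_ tF'] H.
    have [|e [a1 a2 a3]] := doubled_step_undouble hF hi tF (G := undouble i F).
      by [].
    have [|e' [b1 b2 b3]] := doubled_step_undouble hF' hi tF' (G := undouble i F').
      by [].
    have ee : e = e'.
      have := a1 0%N hn; have := b1 0%N hn; have := H i 0%N; have := H i.+1 0%N.
      by move=> /(_ hi hn) -> /(_ (ltnW hi) hn) ->; lia.
    move=> r j hr hj; case: (leqP r i) => hri.
      by rewrite a2 // b2 // H //; lia.
    have er : r = r.-1.+1 by lia.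
    by rewrite er a3 ?b3 ?H //; lia.
Qed.

Lemma sum_negb N (b : nat -> bool) :
  (\sum_(i < N) ~~ b i = N - \sum_(i < N) b i)%N.
Proof.
suff : (\sum_(i < N) ~~ b i + \sum_(i < N) b i = N)%N by lia.
rewrite -big_split /= -[RHS](card_ord N) -sum1_card.
by apply: eq_bigr => i _; case: (b i).
Qed.

(** Double counting of the pairs of a height function and a constant step, which
    correspond to the pairs of a height function on one more row and two equal
    consecutive steps. *)
Lemma class_count_rec T k u l v m n : (0 < n)%N ->
  ((m.-1 - u) * class_count T k u l v m n =
   (m.-1 - k) * class_count T k u l v m.+1 n)%N.
Proof.
move=> hn; rewrite /class_count.
rewrite -(@sum_count_heights m n _ m.-1 _ (uneven n)); last first.
  by move=> F _ /and5P[_ _ /eqP <- _ _]; rewrite sum_negb.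
rewrite -(@sum_count_heights m.+1 n _ m.-1 _ (turn n)); last first.
  by move=> F _ /and5P[_ /eqP <- _ _ _]; rewrite sum_negb.
apply: eq_bigr => i _; apply: class_count_double => //.
by have := ltn_ord i; lia.
Qed.

(** The recurrence determines [f] from its value at [k.+2], the first place
    where the right-hand factor is nonzero.  If [u > k], the left-hand factor
    is zero there and [f] vanishes from then on. *)
Lemma solve_rec (f : nat -> nat) k u :
  (forall m, (m.-1 - u) * f m = (m.-1 - k) * f m.+1)%N ->
  forall m, (k.+2 < m)%N ->
    (f m = (if (u <= k)%N then f k.+2 else 0) * 'C(m - u.+2, k - u))%N.
Proof.
move=> H m; case: (leqP u k) => huk hm; last first.
  rewrite /= mul0n; elim: m hm => // m IH.
  rewrite ltnS leq_eqVlt => /orP[/eqP<-|hm].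
    have := H k.+2; rewrite /= (_ : k.+1 - u = 0)%N; last by lia.
    by rewrite subSnn mul1n mul0n.
  have := H m; rewrite IH // muln0 => /esym/eqP; rewrite muln_eq0.
  by case/orP=> /eqP //; lia.
rewrite /=; elim: m hm => // m IH; rewrite ltnS leq_eqVlt => hm.
have {}IH : (f m = f k.+2 * 'C(m - u.+2, k - u))%N.
  case/orP: hm => [/eqP<-|/IH//].
  by rewrite !subSS binn muln1.
have hp : (0 < m.-1 - k)%N by lia.
apply/eqP; rewrite -(eqn_pmul2l hp); apply/eqP.
rewrite -H IH !mulnA ![(_ * f k.+2)%N]mulnC -!mulnA; congr (_ * _)%N.
have := mul_bin_down (m.-1 - u) (k - u).
rewrite (_ : (m.-1 - u).-1 = m - u.+2)%N; last by lia.
rewrite (_ : m.-1 - u - (k - u) = m.-1 - k)%N; last by lia.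
by rewrite (_ : m.+1 - u.+2 = m.-1 - u)%N //; lia.
Qed.

Lemma class_count_rows T k u l v m n : (k.+2 < m)%N -> (0 < n)%N ->
  (class_count T k u l v m n =
   (if (u <= k)%N then class_count T k u l v k.+2 n else 0) *
     'C(m - u.+2, k - u))%N.
Proof.
move=> hm hn; apply: (@solve_rec (fun m => class_count T k u l v m n)) hm => m'.
exact: class_count_rec.
Qed.

Lemma class_count_cols T k u l v m n : (l.+2 < n)%N -> (0 < m)%N ->
  (class_count T k u l v m n =
   (if (v <= l)%N then class_count T k u l v m l.+2 else 0) *
     'C(n - v.+2, l - v))%N.
Proof.
move=> hn hm; rewrite class_count_transp class_count_rows //.
by rewrite [in RHS]class_count_transp.
Qed.

Definition class_base T k u l v : nat :=
  if (u <= k)%N && (v <= l)%N then class_count T k u l v k.+2 l.+2 else 0%N.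

Lemma class_countE T k u l v m n : (k.+2 < m)%N -> (l.+2 < n)%N ->
  (class_count T k u l v m n =
   class_base T k u l v * ('C(m - u.+2, k - u) * 'C(n - v.+2, l - v)))%N.
Proof.
move=> hm hn; rewrite class_count_rows //; last by lia.
rewrite (@class_count_cols T k u l v k.+2 n) // /class_base.
case: (u <= k)%N; case: (v <= l)%N; rewrite ?mul0n //=.
by rewrite -mulnA [X in (_ * X)%N]mulnC.
Qed.

(** * Functions with all minima on one side *)

Definition sgn (b : bool) : int := if b then 1 else -1.

(** On two columns these are the functions all of whose steps between rows are
    constant and all of whose interior rows are turns. *)
Definition zigzag (b c : bool) (i j : nat) : int :=
  (if odd i then sgn b else 0) + (if odd j then sgn c else 0).

Definition side_type (d x y : nat) (z : bool) : bool := ((x + y)%N == d) && z.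

Lemma zigzag_strict_ext m b c F s i j : (1 < m)%N ->
  agree m 2 F (zigzag b c) -> (i < m)%N -> (j < 2)%N ->
  strict_ext s m 2 F i j = (s == sgn (b (+) odd i)) && (s == sgn (c (+) odd j)).
Proof.
move=> hm hF hi hj; rewrite /strict_ext.
have hu : ((i.+1 < m)%N ==> (F i.+1 j == F i j + s)) &&
          ((0 < i)%N ==> (F i.-1 j == F i j + s)) = (s == sgn (b (+) odd i)).
  case: i hi => [|i] hi.
    by rewrite hm !hF // /zigzag /=; case: b hF => hF /=; lia.
  rewrite /= !(hF i) ?(hF i.+1) //; last by lia.
  case: (ltnP i.+2 m) => /= h; rewrite ?hF // /zigzag /=;
  by case: b hF => hF; case: (odd i) => /=; lia.
have hv : ((j.+1 < 2)%N ==> (F i j.+1 == F i j + s)) &&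
          ((0 < j)%N ==> (F i j.-1 == F i j + s)) = (s == sgn (c (+) odd j)).
  case: j hj {hu} => [|[|j]] //= hj; rewrite ?andbT !hF // /zigzag /=;
  by case: c hF => hF; case: (odd i) => /=; lia.
by rewrite andbA hu hv.
Qed.

Lemma zigzag_in_class k b c F : agree k.+2 2 F (zigzag b c) ->
  in_class (side_type k.+2) k 0 0 0 k.+2 2 F.
Proof.
move=> hF; have hext s i j := @zigzag_strict_ext k.+2 b c F s i j isT hF.
apply/and5P; split.
- apply/andP; split.
    rewrite /num_ext -big_split /= -[X in _ == X]card_ord -sum1_card; apply/eqP.
    apply: eq_bigr => i _; rewrite !big_ord_recl !big_ord0 /= !hext //=.
    by case: b {hF hext}; case: c; case: (odd i).
  apply/or4P; case: c hF hext => hF hext; [apply: Or43 | apply: Or44];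
  apply/'forall_forallP => i [[|[|j]] hj] //=; apply/implyP; rewrite hext //=;
  by move=> /andP[_ /eqP].
- rewrite /num_turn /= -[X in _ == X]card_ord -sum1_card; apply/eqP.
  apply: eq_bigr => r _; rewrite (_ : turn _ _ _ = true) //.
  apply/existsP; exists ord0; have hr := ltn_ord r.
  by rewrite !hF ?ltnS // ?(ltnW hr) // /zigzag /=;
     case: b {hF hext}; case: (odd r) => /=; lia.
- rewrite /num_uneven big1 // => r _; rewrite (_ : uneven _ _ _ = false) //.
  apply/negbTE/existsPn => j; rewrite negbK; have hr := ltn_ord r.
  rewrite !hF //; try by move: hr => /=; lia.
  by rewrite /zigzag; lia.
- by rewrite /num_turn big_ord0.
- rewrite /num_uneven big_ord_recl big_ord0 (_ : uneven _ _ _ = false) //.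
  apply/negbTE/existsPn => j; rewrite negbK /transp !hF //.
  by rewrite /zigzag; lia.
Qed.

Lemma zigzag_height m b c F : (0 < m)%N -> agree m 2 F (zigzag b c) ->
  height m 2 F.
Proof.
move=> hm hF; split.
- move=> i j hi hj; rewrite !hF ?(ltnW hi) // /zigzag /=.
  by case: b hF => hF; case: (odd i) => /=; lia.
- move=> i j hi hj; rewrite !hF ?(ltnW hj) // /zigzag /=.
  by case: c hF => hF; case: (odd j) => /=; lia.
- by rewrite hF.
Qed.

Lemma class_base_side k :
  (4 <= class_base (side_type k.+2) k 0 0 0)%N.
Proof.
rewrite /class_base /= /class_count /count_heights -size_filter.
pose f (x : bool * bool) := to_grid k.+2 2 (zigzag x.1 x.2).
pose s := [:: (true, true); (true, false); (false, true); (false, false)].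
have hf x : agree k.+2 2 (of_grid (f x)) (zigzag x.1 x.2).
  by move=> i j hi hj; rewrite to_gridK.
rewrite -[4%N](size_map f s); apply: uniq_leq_size.
  rewrite map_inj_uniq // => x y e.
  have h1 := hf x 1%N 0%N isT isT; have h2 := hf x 0%N 1%N isT isT.
  move: h1 h2; rewrite e !hf //; case: x y {e} => [x1 x2] [y1 y2].
  by case: x1 x2 y1 y2 => [] [] [] [].
move=> _ /mapP[x _ ->]; rewrite mem_filter mem_heights (zigzag_in_class (hf x)).
by apply/is_heightP; apply: (zigzag_height _ (hf x)).
Qed.

Lemma E_count d m n : (1 < m)%N -> E d m n =
  count_heights m n (fun F => num_ext 1 m n F + num_ext (-1) m n F == d)%N.
Proof. by move=> hm; apply: num_heightsE => h; rewrite card_extrema. Qed.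

Definition remainder_type (a b x y : nat) (z : bool) : bool :=
  [&& x == a, y == b & ~~ z].

Lemma remainder_count a b m n : remainder a b m n =
  count_heights m n (fun F =>
    remainder_type a b (num_ext 1 m n F) (num_ext (-1) m n F)
      (minima_on_side m n F)).
Proof.
apply: num_heightsE => h.
by rewrite card_local_minima card_local_maxima on_single_sideE.
Qed.

(** Three disjoint families of functions with [k.+2] extrema: the remainder, and
    for rows and for columns the functions with [k] turns in this direction, no
    turn in the other one, no uneven step and their minima on one side.  The
    location of the minima separates the first family from the others, and the
    direction of the turns separates these two. *)
Lemma remainder_upper_bound k a b m n : (0 < k)%N -> (a + b)%N = k.+2 ->
  (k.+2 < m)%N -> (k.+2 < n)%N ->
  (remainder a b m n + 4 * 'C(m - 2, k) + 4 * 'C(n - 2, k) <= E k.+2 m n)%N.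
Proof.
move=> hk hab hm hn.
have c0 : (4 * 'C(m - 2, k) <= class_count (side_type k.+2) k 0 0 0 m n)%N.
  rewrite class_countE //; last by lia.
  by rewrite !subn0 bin0 muln1 leq_mul2r class_base_side orbT.
have c1 : (4 * 'C(n - 2, k) <= class_count (side_type k.+2) 0 0 k 0 m n)%N.
  rewrite class_count_transp class_countE //; last by lia.
  by rewrite !subn0 bin0 muln1 leq_mul2r class_base_side orbT.
apply: leq_trans (leq_add (leq_add (leqnn _) c0) c1) _.
rewrite remainder_count E_count; last by lia.
rewrite /class_count !count_heights_disjoint.
- apply: sub_count_heights => F _ /orP[/orP[]|].
  + by case/and3P=> /eqP -> /eqP -> _; apply/eqP.
  + by case/and5P=> /andP[].
  + by case/and5P=> /andP[].
- move=> F _ /orP[/and3P[_ _ hs]|/and5P[_ /eqP ht _ _ _]]; apply/negP => /and5P.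
    by case=> /andP[_]; rewrite (negbTE hs).
  by case=> _; rewrite ht; lia.
- move=> F _ /and3P[_ _ hs]; apply/negP => /and5P[/andP[_]].
  by rewrite (negbTE hs).
Qed.

(** The largest possible value of a statistic is [a + b + 1], for the number of
    uneven steps, which may exceed the number of turns by one. *)
Lemma remainder_sum a b m n (D := (a + b).+2) :
  remainder a b m n = (\sum_(k < D) \sum_(u < D) \sum_(l < D) \sum_(v < D)
    class_count (remainder_type a b) k u l v m n)%N.
Proof.
rewrite remainder_count.
have bound F m' n' : height m' n' F -> (num_ext 1 m' n' F = a)%N ->
    num_ext (-1) m' n' F = b ->
    (num_turn m' n' F < D)%N /\ (num_uneven m' n' F < D)%N.
  move=> hF h1 h2; have := num_turn_le hF; have := num_uneven_le hF.
  by rewrite h1 h2 /D; lia.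
rewrite (@count_heights_partition m n _ (num_turn m n) D); last first.
  by move=> F hF /and3P[/eqP h1 /eqP h2 _]; case: (bound F m n).
apply: eq_bigr => k _.
rewrite (@count_heights_partition m n _ (num_uneven m n) D); last first.
  by move=> F hF /andP[/and3P[/eqP h1 /eqP h2 _] _]; case: (bound F m n).
apply: eq_bigr => u _.
rewrite (@count_heights_partition m n _
  (fun F => num_turn n m (transp F)) D); last first.
  move=> F hF /andP[/andP[/and3P[/eqP h1 /eqP h2 _] _] _].
  case: (bound (transp F) n m); rewrite ?(num_ext_transp _ m n F) //.
  exact: height_transp.
apply: eq_bigr => l _.
rewrite (@count_heights_partition m n _
  (fun F => num_uneven n m (transp F)) D); last first.
  move=> F hF /andP[/andP[/andP[/and3P[/eqP h1 /eqP h2 _] _] _] _].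
  case: (bound (transp F) n m); rewrite ?(num_ext_transp _ m n F) //.
  exact: height_transp.
apply: eq_bigr => v _; apply: eq_count_heights => F _.
by rewrite /in_class !andbA.
Qed.

(** * Binomial polynomials and growth *)

(** Otherwise [A - Q] has the positive leading coefficient of [A] and is
    eventually positive. *)
Lemma size_le_of_bound (A Q : {poly rat}) (N : nat) : 0 < lead_coef A ->
  (forall t : nat, (N <= t)%N -> A.[t%:R] <= Q.[t%:R]) ->
  (size A <= size Q)%N.
Proof.
move=> hA H; rewrite leqNgt; apply/negP => hs.
have hl : lead_coef (A - Q) = lead_coef A by rewrite lead_coefDl // size_polyN.
have [|x0 hx] := @poly_pinfty_gt_lc _ (A - Q); first by rewrite hl.
pose t := maxn N (Num.bound `|x0|).
have ht : x0 <= t%:R.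
  apply: ltW; apply: lt_le_trans (_ : (Num.bound `|x0|)%:R <= _); last first.
    by rewrite ler_nat leq_maxr.
  apply: le_lt_trans (ler_norm _) _.
  by apply: archi_boundP; apply: normr_ge0.
have := hx _ ht; rewrite hl hornerD hornerN => h.
have := H t (leq_maxl _ _); rewrite -subr_le0 => h'.
by have := lt_le_trans hA (le_trans h h'); rewrite ltxx.
Qed.

(** The binomial coefficient C(t - c, r) as a polynomial in [t]. *)
Definition bin_poly (c r : nat) : {poly rat} :=
  (r`!%:R^-1) *: \prod_(i < r) ('X - (c + i)%:R%:P).

Lemma bin_poly_eval c r t : (c <= t)%N ->
  (bin_poly c r).[t%:R] = 'C(t - c, r)%:R.
Proof.
move=> hc; have hr : (r`!)%:R != 0 :> rat by rewrite pnatr_eq0 -lt0n fact_gt0.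
apply: (mulfI hr); rewrite hornerZ mulVKf // -natrM mulnC bin_ffact.
elim: r {hr} => [|r IH]; first by rewrite big_ord0 hornerC ffactn0.
rewrite big_ord_recr hornerM IH ffactnSr natrM hornerXsubC /=.
case: (leqP r (t - c)) => hr.
  by rewrite -natrB -?subnDA //; lia.
by rewrite ffact_small // !mul0r.
Qed.

Lemma size_bin_poly c r : size (bin_poly c r) = r.+1.
Proof.
rewrite /bin_poly size_scale ?size_prod_XsubC ?invr_eq0 ?pnatr_eq0 -?lt0n ?fact_gt0 //.
by rewrite /index_enum -enumT size_enum_ord.
Qed.

Lemma lead_coef_bin_poly c r : lead_coef (bin_poly c r) = (r`!)%:R^-1.
Proof.
by rewrite /bin_poly lead_coefZ (monicP (monic_prod_XsubC _ _ _)) mulr1.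
Qed.

Definition in_var (i : 'I_2) (p : {poly rat}) : {mpoly rat[2]} :=
  \sum_(k < size p) p`_k *: 'X_i ^+ k.

Lemma in_var_eval i p v : (in_var i p).@[v] = p.[v i].
Proof.
rewrite /in_var raddf_sum horner_coef; apply: eq_bigr => k _ /=.
by rewrite mevalZ rmorphXn /= mevalXU.
Qed.

Lemma msize_in_var i p : (msize (in_var i p) <= size p)%N.
Proof.
apply: leq_trans (msize_sum _ _ _) _.
apply/bigmax_leqP_seq => k _ _; apply: leq_trans (msizeZ_le _ _) _.
by rewrite mpolyXn msizeX mdegMn mdeg1 mul1n.
Qed.

(** The restriction of [p] to the line where both variables are equal. *)
Definition diagonal (p : {mpoly rat[2]}) : {poly rat} :=
  \sum_(m <- msupp p) p@_m *: 'X^(mdeg m).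

Lemma diagonal_eval p t : (diagonal p).[t%:R] = eval2 p t t.
Proof.
rewrite /diagonal /eval2 mevalE horner_sum; apply: eq_bigr => m _.
rewrite hornerZ hornerXn mdegE; congr (_ * _).
rewrite -prodrXr; apply: eq_bigr => i _; by case: ifP.
Qed.

Lemma size_diagonal p : (size (diagonal p) <= msize p)%N.
Proof.
rewrite /diagonal big_seq; apply: leq_trans (size_sum _ _ _) _.
apply/bigmax_leqP_seq => m _ hm; apply: leq_trans (size_scale_leq _ _) _.
by rewrite size_polyXn; apply: msize_mdeg_lt.
Qed.

(** On the diagonal all monomials of one total degree merge into one. *)
Lemma coef_diagonal p k : (diagonal p)`_k = (pihomog mdeg k p).@[fun=> 1].
Proof.
rewrite /diagonal coef_sum pihomogE raddf_sum [RHS]big_mkcond /=.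
apply: eq_bigr => m _; rewrite coefZ coefXn eq_sym.
case: eqP => h; rewrite ?mulr0 // mevalZ mevalX big1 // => i _.
by rewrite expr1n.
Qed.

(** * The remainder polynomial *)

(** The upper bound for the remainder on the diagonal; the factor 8 is 4 for the
    rows plus 4 for the columns. *)
Definition gap_poly (k : nat) (p : {mpoly rat[2]}) : {poly rat} :=
  diagonal p - 8%:R *: bin_poly 2 k.

(** Both leading terms are 8 / k! times the k-th power, so they cancel. *)
Lemma size_gap_poly k p : total_degree_le p k ->
  pihomog mdeg k p = (4%:R / (k`!)%:R : rat) *:
             ('X_(0 : 'I_2) ^+ k + 'X_(1 : 'I_2) ^+ k) ->
  (size (gap_poly k p) <= k)%N.
Proof.
move=> hp hlead; apply/leq_sizeP => j hj; rewrite coefB coefZ.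
move: hj; rewrite leq_eqVlt => /orP[/eqP <-|hj].
  rewrite coef_diagonal hlead mevalZ mevalD !rmorphXn /= !mevalXU !expr1n.
  have -> : (bin_poly 2 k)`_k = (k`!)%:R^-1.
    by rewrite -(lead_coef_bin_poly 2) /lead_coef size_bin_poly.
  by rewrite mulrAC -mulrBl (_ : 4%:R * (1 + 1) - 8%:R = 0) ?mul0r.
rewrite !nth_default ?mulr0 ?subr0 ?size_bin_poly //.
exact: leq_trans (size_diagonal _) (leq_trans hp hj).
Qed.

(** A class that occurs at all contributes a product of binomial coefficients
    that stays, on the diagonal, below a polynomial of degree less than [k]. *)
Lemma class_degree k p a b i u j v : (2 < k)%N -> (a + b)%N = k.+2 ->
  agrees_from k.+1 (E k.+2) p -> (size (gap_poly k p) <= k)%N ->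
  (0 < class_base (remainder_type a b) i u j v)%N ->
  ((i - u + (j - v)).+1 <= k)%N.
Proof.
move=> hk hab hp hs hc; set c := class_base _ _ _ _ _ in hc.
pose A := c%:R *: (bin_poly u.+2 (i - u) * bin_poly v.+2 (j - v)).
have c0 : c%:R != 0 :> rat by rewrite pnatr_eq0 -lt0n.
have sA : size A = (i - u + (j - v)).+1.
  by rewrite size_scale // size_mul -?size_poly_eq0 ?size_bin_poly //; lia.
apply: leq_trans hs; rewrite -sA.
(* From here on no subtraction of naturals below is truncated. *)
apply: (@size_le_of_bound _ _ (k + i + j + u + v).+3).
  rewrite lead_coefZ lead_coefM !lead_coef_bin_poly.
  by rewrite !mulr_gt0 ?invr_gt0 ?ltr0n ?fact_gt0.
move=> t ht; rewrite hornerZ hornerM !bin_poly_eval; try lia.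
rewrite hornerD hornerN hornerZ bin_poly_eval; try lia.
rewrite diagonal_eval -hp; try lia.
rewrite -!natrM lerBrDr -natrD ler_nat -class_countE; try lia.
apply: leq_trans (@remainder_upper_bound k a b t t _ hab _ _); try lia.
rewrite -addnA -mulnDl leq_add2r remainder_count.
by apply: sub_count_heights => F _ /and5P[].
Qed.

Definition remainder_poly (a b : nat) (D := (a + b).+2) : {mpoly rat[2]} :=
  \sum_(k < D) \sum_(u < D) \sum_(l < D) \sum_(v < D)
    (class_base (remainder_type a b) k u l v)%:R *:
      (in_var 0 (bin_poly u.+2 (k - u)) * in_var 1 (bin_poly v.+2 (l - v))).

Lemma remainder_poly_agrees a b :
  agrees_from (a + b).+4 (remainder a b) (remainder_poly a b).
Proof.
move=> m n hm hn; rewrite remainder_sum /eval2 /remainder_poly.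
rewrite natr_sum raddf_sum /=; apply: eq_bigr => k _.
rewrite natr_sum raddf_sum /=; apply: eq_bigr => u _.
rewrite natr_sum raddf_sum /=; apply: eq_bigr => l _.
rewrite natr_sum raddf_sum /=; apply: eq_bigr => v _.
have := ltn_ord k; have := ltn_ord u; have := ltn_ord l; have := ltn_ord v.
move=> hv hl hu hk.
rewrite mevalZ mevalM !in_var_eval /= !bin_poly_eval; try lia.
by rewrite class_countE ?natrM //; lia.
Qed.

Lemma total_degree_le_sum (I : eqType) (r : seq I) (P : pred I)
    (F : I -> {mpoly rat[2]}) k :
  (forall i, P i -> total_degree_le (F i) k) ->
  total_degree_le (\sum_(i <- r | P i) F i) k.
Proof.
move=> H; apply: leq_trans (msize_sum _ _ _) _.
by apply/bigmax_leqP_seq => i _; apply: H.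
Qed.

Lemma total_degree_le_mul (x y : {mpoly rat[2]}) i j :
  total_degree_le x i -> total_degree_le y j -> total_degree_le (x * y) (i + j).
Proof.
rewrite /total_degree_le.
have [->|nx] := eqVneq x 0; first by rewrite mul0r msize0.
have [->|ny] := eqVneq y 0; first by rewrite mulr0 msize0.
by rewrite msizeM //; move: (msize x) (msize y) => s t; lia.
Qed.

Lemma total_degree_le_bin_poly i c r :
  total_degree_le (in_var i (bin_poly c r)) r.
Proof. by have := msize_in_var i (bin_poly c r); rewrite size_bin_poly. Qed.

Theorem proposition8p5 (d : nat) (hd : (5 <= d)%N) (p : {mpoly rat[2]})
  (hp : agrees_from (maxn (d - 1) 2) (E d) p)
  (hdeg : total_degree_le p (d - 2))
  (hlead : pihomog mdeg (d - 2) p =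
           (4%:R / ((d - 2)`!)%:R : rat) *:
             ('X_(0 : 'I_2) ^+ (d - 2) + 'X_(1 : 'I_2) ^+ (d - 2)))
  (a b : nat) (ha : (1 <= a)%N) (hab : (a <= b)%N) (habd : (a + b)%N = d) :
  exists q : {mpoly rat[2]},
    agrees_from (2 * d - 1) (remainder a b) q /\ total_degree_le q (d - 3).
Proof.
have [k dk] : exists k, d = k.+2 by exists (d - 2)%N; lia.
rewrite dk (_ : k.+2 - 2 = k)%N in hdeg hlead; last by lia.
have hgap := size_gap_poly hdeg hlead.
exists (remainder_poly a b); split.
  by move=> m n hm hn; apply: remainder_poly_agrees; lia.
do 4!(apply: total_degree_le_sum => ? _).
set c := class_base _ _ _ _ _.
have [->|c0] := posnP c; first by rewrite scale0r /total_degree_le msize0.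
apply: leq_trans (msizeZ_le _ _) _.
have hk : (2 < k)%N by lia.
rewrite dk (_ : maxn _ _ = k.+1) in hp; last by lia.
have hc := class_degree hk (etrans habd dk) hp hgap c0.
apply: leq_trans (total_degree_le_mul _ _) _.
- exact: total_degree_le_bin_poly.
- exact: total_degree_le_bin_poly.
by apply: leq_trans hc _; lia.
Qed.
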